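(* Let $n>2$ and let $S$ be the set of triplets $(i,j,k)\in\{1,\dots,n\}^3$ with at least two distinct entries. For a monomial $f$ in the variables $P_{ijk}$ ($1\le i,j,k\le n$) let $\overline{f}$ denote any monomial obtained from a matrix in the set $\Sigma(A_f)$. Then the following polynomials are invariants for the model $qI_n$ (that is, they belong to the homogeneous ideal of the variety $V_{qI_n}$): (i) $P_{ijk}P_{i'j'k'}-\overline{P_{ijk}P_{i'j'k'}}$, where $(i,j,k),(i',j',k')\in S$ are distinct; (ii) $P_{iii}P_{klm}P_{qrs}-\overline{P_{iii}P_{klm}P_{qrs}}$, where $(k,l,m),(q,r,s)\in S$ are distinct and there exists $a\in\{1,\dots,n\}\setminus\{i\}$ such that $a\in\{k,q\}\cap\{l,r\}\cap\{m,s\}$ (so that changing the indices one can get another diagonal element $P_{aaa}$ different from $P_{iii}$); (iii) $P_{ijk}P_{i'j'k'}P_{i''j''k''}-\overline{P_{ijk}P_{i'j'k'}P_{i''j''k''}}$, where $(i,j,k),(i',j',k'),(i'',j'',k'')\in S$ and at least two of these triplets are distinct; (iv) $P_{iii}P_{klm}P_{qrs}P_{xyz}-\overline{P_{iii}P_{klm}P_{qrs}P_{xyz}}$, where $(k,l,m),(q,r,s),(x,y,z)\in S$, at least two of these triplets are distinct, and there exists $a\in\{1,\dots,n\}\setminus\{i\}$ such that $a\in\{k,q,x\}\cap\{l,r,y\}\cap\{m,s,z\}$ (so that changing the indices one can get another diagonal element $P_{aaa}$ different from $P_{iii}$); (v) $P_{iii}P_{klm}P_{qrs}P_{tuv}P_{xyz}-\overline{P_{iii}P_{klm}P_{qrs}P_{tuv}P_{xyz}}$,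 where $(k,l,m),(q,r,s),(t,u,v),(x,y,z)\in S$, at least three of these triplets are distinct, and there exists $a\in\{1,\dots,n\}\setminus\{i\}$ such that $a\in\{k,q,t,x\}\cap\{l,r,u,y\}\cap\{m,s,v,z\}$ (so that changing the indices one can get another diagonal element $P_{aaa}$ different from $P_{iii}$).
   Context: We work over $\mathbb{C}$; $P_{ijk}$, $1\le i,j,k\le n$, are homogeneous coordinates on $\mathbb{P}^{n^3-1}$. The model $qI_n$ is given by $P_{ijk}=\zeta\gamma a_ib_jc_k$ if $i=j=k$ and $P_{ijk}=\zeta a_ib_jc_k$ otherwise. The associated variety $V_{qI_n}\subset\mathbb{P}^{n^3-1}$ is the Zariski closure of the set of all points $[P_{ijk}]$ with $P_{iii}=u\,a_ib_ic_i$ and $P_{ijk}=v\,a_ib_jc_k$ for $i,j,k$ not all equal, where $a,b,c\in\mathbb{C}^n$ and $u,v\in\mathbb{C}$ are such that not all $P_{ijk}$ vanish. Matrix of a monomial: to a monomial $f=P_{i_1j_1k_1}^{\alpha_1}\cdots P_{i_mj_mk_m}^{\alpha_m}$ of degree $t=\sum_s\alpha_s$ associate the $t\times 3$ matrix $A_f$ whose rows are the triplets $(i_s\ j_s\ k_s)$, each repeated $\alpha_s$ times. Conversely, a $t\times3$ matrix with entries in $\{1,\dots,n\}$ gives the monomial which is the product over its rows $(i\ j\ k)$ of the variables $P_{ijk}$. For a $t\times3$ matrix $A=(a_{pq})$ let $\rho(A)=\#\{s: a_{s1}=a_{s2}=a_{s3}\}$. Let $S_t$ be the group of permutations of $\{1,\dots,t\}$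 and $Diag=\{(\sigma_1,\sigma_2,\sigma_3)\in (S_t)^3:\sigma_1=\sigma_2=\sigma_3\}$. For $\sigma=(\sigma_1,\sigma_2,\sigma_3)\in(S_t)^3\setminus Diag$, let $F_\sigma(A)$ be the $t\times 3$ matrix whose $s$-th row is $(a_{\sigma_1(s)1}\ a_{\sigma_2(s)2}\ a_{\sigma_3(s)3})$. Define $$\Sigma(A)=\{F_\sigma(A):\sigma\in(S_t)^3\setminus Diag,\ \rho(F_\sigma(A))=\rho(A),\ \text{and no exchange of two rows of } F_\sigma(A) \text{ yields } A\}.$$ *)

(* Defs.v *)
From mathcomp Require Export all_boot all_order all_algebra.
From mathcomp Require Export fingroup perm.
From mathcomp Require Export classical_sets reals.
From mathcomp Require Export complex mpoly.

Set Implicit Arguments.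
Unset Strict Implicit.
Unset Printing Implicit Defensive.

Import GRing.Theory.
Local Open Scope ring_scope.

(* The field C is R[i] for R : realType. The indices 1, ..., n are the elements
   of 'I_n. *)

Definition triple (n : nat) : finType := ('I_n * 'I_n * 'I_n)%type.

Definition diagonal n (x : triple n) : bool :=
  (x.1.1 == x.1.2) && (x.1.2 == x.2).

Definition offdiag n : {set triple n} := [set x | ~~ diagonal x].

(* The coordinate ring of P^(n^3 - 1): one variable for each of the
   #|{: triple n}| = n^3 triples, numbered by enum_rank. *)
Definition cring (R : realType) (n : nat) := {mpoly R[i][#|{: triple n}|]}.

Definition Pvar (R : realType) n (i j k : 'I_n) : cring R n :=
  'X_(enum_rank ((i, j, k) : triple n)).

(* A point of projective space is represented by its nonzero coordinate
   vectors, and a subset by the set of all representatives of its points. *)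
Definition coords (R : realType) (n : nat) := {ffun triple n -> R[i]}.

Definition eval_at (R : realType) n (v : coords R n) (p : cring R n) : R[i] :=
  p.@[fun e => v (enum_val e)].

Definition homogeneous (R : realType) n (p : cring R n) : Prop :=
  exists d : nat, p \is d.-homog.

Section ProjectiveSets.
Local Open Scope classical_set_scope.
Variables (R : realType) (n : nat).

Definition zero_locus (T : set (cring R n)) : set (coords R n) :=
  [set v : coords R n | v != 0 /\ forall p, T p -> eval_at v p = 0].

Definition zariski_closed (Z : set (coords R n)) : Prop :=
  exists2 T : set (cring R n), T `<=` @homogeneous R n & Z = zero_locus T.

Definition zariski_closure (X : set (coords R n)) : set (coords R n) :=
  smallest zariski_closed X.

Definition is_ideal (I : set (cring R n)) : Prop :=
  [/\ I 0,
      (forall p q, I p -> I q -> I (p + q)) &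
      (forall p q, I q -> I (p * q))].

Definition homogeneous_ideal (V : set (coords R n)) : set (cring R n) :=
  smallest is_ideal
    [set p : cring R n | homogeneous p /\ forall v, V v -> eval_at v p = 0].

Definition qI_points : set (coords R n) :=
  [set v : coords R n | v != 0 /\
    exists (a b c : 'I_n -> R[i]) (u w : R[i]), forall i j k : 'I_n,
      v (i, j, k) =
        (if diagonal (i, j, k) then u else w) * a i * b j * c k].

Definition V_qI : set (coords R n) := zariski_closure qI_points.

End ProjectiveSets.

Definition row_triple n t (A : 'M['I_n]_(t, 3)) (s : 'I_t) : triple n :=
  (A s 0, A s 1, A s 2%:R).

Definition matrix_monomial (R : realType) n t (A : 'M['I_n]_(t, 3)) :
    cring R n :=
  \prod_(s < t) Pvar R (A s 0) (A s 1) (A s 2%:R).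

Definition rho n t (A : 'M['I_n]_(t, 3)) : nat :=
  #|[set s | diagonal (row_triple A s)]|.

(* The component sigma q permutes column q. *)
Definition Diag (t : nat) : {set {ffun 'I_3 -> 'S_t}} :=
  [set sigma : {ffun 'I_3 -> 'S_t} | (sigma 0 == sigma 1) && (sigma 1 == sigma 2%:R)].

Definition Fsigma n t (sigma : {ffun 'I_3 -> 'S_t}) (A : 'M['I_n]_(t, 3)) :
    'M['I_n]_(t, 3) :=
  \matrix_(s < t, q < 3) A (sigma q s) q.

Definition row_exchange n t (A B : 'M['I_n]_(t, 3)) : bool :=
  [exists s1, exists s2, (s1 != s2) && (xrow s1 s2 B == A)].

Definition Sigma n t (A : 'M['I_n]_(t, 3)) : {set 'M['I_n]_(t, 3)} :=
  [set Fsigma sigma A | sigma in ~: Diag t &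
     (rho (Fsigma sigma A) == rho A) && ~~ row_exchange A (Fsigma sigma A)].

(* g is one of the monomials denoted by overlining f. The matrix A_f is only
   determined up to the order of its rows; all orders are allowed here. *)
Definition overline (R : realType) n (f g : cring R n) : Prop :=
  exists (t : nat) (A : 'M['I_n]_(t, 3)),
    f = matrix_monomial R A /\
    exists2 B : 'M['I_n]_(t, 3), B \in Sigma A & g = matrix_monomial R B.

(* Main.v *)
(* At a point with [v (i, j, k) = (u or w) * a i * b j * c k], the monomial of a
   matrix A takes the value
     u ^ rho(A) * w ^ (t - rho(A)) * \prod_s a (A s 0) b (A s 1) c (A s 2).
   Permuting the columns of A only reorders the factors of the product, so A and
   any matrix of Sigma(A), having the same rho, give equal values. The polynomial
   f - \overline{f} is thus homogeneous and vanishes on the points of the model,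
   hence on their Zariski closure. *)
Require Import Defs.

Set Implicit Arguments.
Unset Strict Implicit.
Unset Printing Implicit Defensive.

Import GRing.Theory.
Local Open Scope ring_scope.

Lemma eval_matrix_monomial (R : realType) n t (A : 'M['I_n]_(t, 3))
    (v : coords R n) :
  eval_at v (matrix_monomial R A) = \prod_(s < t) v (row_triple A s).
Proof.
rewrite /eval_at /matrix_monomial rmorph_prod /=.
by apply: eq_bigr => s _; rewrite mevalXU enum_rankK.
Qed.

Lemma dhomog_matrix_monomial (R : realType) n t (A : 'M['I_n]_(t, 3)) :
  matrix_monomial R A \is t.-homog.
Proof.
(* The degree is written as a sum of [t] ones so that product and degree can be built up together,
   one variable per row. *)
suff : matrix_monomial R A \is (\sum_(s < t) 1).-homog.
  by rewrite sum1_card card_ord.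
apply: (big_rec2 (fun p d => p \is d.-homog)) => [|s d p _ hp].
  exact: dhomog1.
by apply: dhomogM => //; rewrite dhomogX /= mdeg1.
Qed.

Lemma prod_qI_rows (R : realType) n t (A : 'M['I_n]_(t, 3))
    (a b c : 'I_n -> R[i]) (u w : R[i]) :
  \prod_(s < t) ((if diagonal (row_triple A s) then u else w) *
                 a (A s 0) * b (A s 1) * c (A s 2%:R)) =
  u ^+ rho A * w ^+ (t - rho A) *
    (\prod_(s < t) a (A s 0)) * (\prod_(s < t) b (A s 1)) *
    \prod_(s < t) c (A s 2%:R).
Proof.
rewrite !big_split /=; do 3!congr (_ * _).
set D := [set s | diagonal (row_triple A s)].
rewrite (bigID (mem D)) /= (eq_bigr (fun=> u)); last first.
  by move=> s; rewrite inE => ->.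
rewrite [X in _ * X](eq_bigr (fun=> w)); last first.
  by move=> s; rewrite inE => /negPf ->.
rewrite !prodr_const; congr (_ * _ ^+ _).
(* Splitting [t] into diagonal and off-diagonal rows shows that the truncated difference [t - rho A]
   is exactly the number of factors [w]. *)
have <- : (#|D| + #|[predC D]| - rho A = t - rho A)%N by rewrite cardC card_ord.
by rewrite addKn.
Qed.

(** Each column is reindexed by its own bijection [sigma q], so the three components of [sigma] may
    be treated independently. *)
Lemma prod_Fsigma_col (T : comPzRingType) n t (sigma : {ffun 'I_3 -> 'S_t})
    (A : 'M['I_n]_(t, 3)) (a : 'I_n -> T) (q : 'I_3) :
  \prod_(s < t) a (Fsigma sigma A s q) = \prod_(s < t) a (A s q).
Proof.
rewrite [RHS](reindex_inj (@perm_inj _ (sigma q))).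
by apply: eq_bigr => s _; rewrite mxE.
Qed.

Lemma eval_Fsigma_qI (R : realType) n t (sigma : {ffun 'I_3 -> 'S_t})
    (A : 'M['I_n]_(t, 3)) (v : coords R n) :
  rho (Fsigma sigma A) = rho A -> qI_points v ->
  eval_at v (matrix_monomial R (Fsigma sigma A)) =
  eval_at v (matrix_monomial R A).
Proof.
move=> rhoE [_ [a [b [c [u [w vE]]]]]].
rewrite !eval_matrix_monomial.
under eq_bigr do rewrite vE.
under [RHS]eq_bigr do rewrite vE.
by rewrite !prod_qI_rows rhoE !prod_Fsigma_col.
Qed.

(** Passage from the parametrized points to their closure: the hypersurface [p = 0] is closed and
    contains these points, hence contains [V_qI], so [p] is one of the generators of the ideal. *)
Lemma homogeneous_ideal_V_qI (R : realType) n (p : cring R n) :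
  homogeneous p -> (forall v, qI_points v -> eval_at v p = 0) ->
  homogeneous_ideal (@V_qI R n) p.
Proof.
move=> hp p0; apply: sub_gen_smallest; split=> // v Vv.
suff [_ ->] : zero_locus [set p]%classic v by [].
(* [Vv] places [v] in every closed set containing [qI_points]; it is used for the locus cut out by
   the single equation [p]. *)
apply: Vv; split; first by exists [set p]%classic => // _ ->.
by move=> x qx; split=> [|_ ->]; [case: qx | exact: p0].
Qed.

(** Common source of all five families. Both monomials come from matrices with [t] rows, so their
    difference is homogeneous of degree [t]. *)
Lemma overline_invariant (R : realType) n (f g : cring R n) :
  overline f g -> homogeneous_ideal (@V_qI R n) (f - g).
Proof.
move=> [t [A [-> [B /imsetP [sigma]]]]].
rewrite inE => /andP [_ /andP [/eqP rhoE _]] -> ->.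
apply: homogeneous_ideal_V_qI.
  by exists t; rewrite rpredB // dhomog_matrix_monomial.
move=> v qv; apply/eqP; rewrite /eval_at mevalB subr_eq0; apply/eqP.
exact/esym/eval_Fsigma_qI.
Qed.

Theorem theorem5p4 (R : realType) (n : nat) (n_gt2 : (2 < n)%N) :
  let P := @Pvar R n in
  let S := offdiag n in
  let I := homogeneous_ideal (@V_qI R n) in
  (* (i) *)
  (forall (i j k i' j' k' : 'I_n) (g : cring R n),
    (i, j, k) \in S -> (i', j', k') \in S ->
    (i, j, k) != (i', j', k') ->
    overline (P i j k * P i' j' k') g ->
    I (P i j k * P i' j' k' - g)) /\
  (* (ii) *)
  (forall (i k l m q r s : 'I_n) (g : cring R n),
    (k, l, m) \in S -> (q, r, s) \in S ->
    (k, l, m) != (q, r, s) ->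
    (exists2 a : 'I_n, a != i &
      a \in [set k; q] :&: [set l; r] :&: [set m; s]) ->
    overline (P i i i * P k l m * P q r s) g ->
    I (P i i i * P k l m * P q r s - g)) /\
  (* (iii) *)
  (forall (i j k i' j' k' i'' j'' k'' : 'I_n) (g : cring R n),
    (i, j, k) \in S -> (i', j', k') \in S -> (i'', j'', k'') \in S ->
    (2 <= #|[set (i, j, k); (i', j', k'); (i'', j'', k'')]|)%N ->
    overline (P i j k * P i' j' k' * P i'' j'' k'') g ->
    I (P i j k * P i' j' k' * P i'' j'' k'' - g)) /\
  (* (iv) *)
  (forall (i k l m q r s x y z : 'I_n) (g : cring R n),
    (k, l, m) \in S -> (q, r, s) \in S -> (x, y, z) \in S ->
    (2 <= #|[set (k, l, m); (q, r, s); (x, y, z)]|)%N ->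
    (exists2 a : 'I_n, a != i &
      a \in [set k; q; x] :&: [set l; r; y] :&: [set m; s; z]) ->
    overline (P i i i * P k l m * P q r s * P x y z) g ->
    I (P i i i * P k l m * P q r s * P x y z - g)) /\
  (* (v) *)
  (forall (i k l m q r s t u v x y z : 'I_n) (g : cring R n),
    (k, l, m) \in S -> (q, r, s) \in S -> (t, u, v) \in S ->
    (x, y, z) \in S ->
    (3 <= #|[set (k, l, m); (q, r, s); (t, u, v); (x, y, z)]|)%N ->
    (exists2 a : 'I_n, a != i &
      a \in [set k; q; t; x] :&: [set l; r; u; y] :&: [set m; s; v; z]) ->
    overline (P i i i * P k l m * P q r s * P t u v * P x y z) g ->
    I (P i i i * P k l m * P q r s * P t u v * P x y z - g)).
Proof.
by do 4![split; first by move=> *; exact: overline_invariant];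
  move=> *; exact: overline_invariant.
Qed.
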